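(* Let $d,k$ be positive integers and $C>0$. Let $z:\mathcal X\to\mathbb R^d$ be a fixed map from individual records to vectors with $\|z(x)\|_2\le C$ for all $x$ (for the remove/add relation $\sim_R$), respectively $\|z(x)\|_2\le C/2$ for all $x$ (for the substitution relation $\sim_S$). Consider the randomised algorithm which, on a dataset $D=(x_1,\dots,x_n)$, (1) draws a matrix $P\in\mathbb R^{d\times k}$ whose entries are independent $\mathcal N(0,1/k)$ random variables, (2) forms $\tilde z=\sum_{x\in D}P^{T}z(x)\in\mathbb R^k$, and (3) returns $\mathcal G(\tilde z)$, where $\mathcal G:\mathbb R^k\to\mathcal R$ is a Gaussian mechanism $\mathcal G(y)=y+\mathcal N(0,\sigma^2 I_k)$ that is $(\epsilon,\delta)$-DP for sensitivity-$\tilde C$ queries. Let $\tilde C>0$ and $\delta'>0$ satisfy $$\mathbb P\Big[\,\Gamma\big(K=\tfrac k2,\ \theta=\tfrac{2C^2}{k}\big)\le \tilde C^2\Big]\ \ge\ 1-\delta',$$ where $\Gamma(K,\theta)$ denotes a Gamma random variable with shape $K$ and scale $\theta$. Then the algorithm is $(\epsilon,\delta+\delta')$-differentially private (with respect to $\sim_R$, respectively $\sim_S$).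
   Context: A randomised mechanism $\mathcal M:\mathcal D\to\mathcal R$ is $(\epsilon,\delta)$-DP ($\epsilon>0$, $\delta\in[0,1]$) if for all neighbouring datasets $D\sim D'$ and all measurable $E\subseteq\mathcal R$, $P(\mathcal M(D)\in E)\le e^{\epsilon}P(\mathcal M(D')\in E)+\delta$. Two neighbouring relations are used: $D\sim_S D'$ (substitution) if $|D|=|D'|$ and they differ in exactly one element; $D\sim_R D'$ (remove/add) if one is obtained from the other by removing or adding a single element. A mechanism $\mathcal G:\mathbb R^k\to\mathcal R$ is said to be $(\epsilon,\delta)$-DP for sensitivity-$\tilde C$ queries if for all $y,y'\in\mathbb R^k$ with $\|y-y'\|_2\le\tilde C$ and all measurable $E$, $P(\mathcal G(y)\in E)\le e^{\epsilon}P(\mathcal G(y')\in E)+\delta$. *)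

(* Defs.v *)
From HB Require Import structures.
From mathcomp Require Import all_boot all_order all_algebra.
From mathcomp Require Import all_classical all_reals all_analysis.
From mathcomp Require Import normal_distribution.

Set Implicit Arguments.
Unset Strict Implicit.
Unset Printing Implicit Defensive.

Import Order.TTheory GRing.Theory Num.Theory.
Local Open Scope classical_set_scope.
Local Open Scope ring_scope.

Section DPdefs.
Context {R : realType}.

(* ---------- vectors in R^n, represented as n.-tuple R (product Borel sigma-algebra) ---------- *)
Definition tadd n (a b : n.-tuple R) : n.-tuple R :=
  [tuple tnth a i + tnth b i | i < n].
Definition tsub n (a b : n.-tuple R) : n.-tuple R :=
  [tuple tnth a i - tnth b i | i < n].
Definition tscale n (c : R) (a : n.-tuple R) : n.-tuple R :=
  [tuple c * tnth a i | i < n].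
Definition tzero n : n.-tuple R := [tuple 0 | i < n].
Definition tnorm2 n (a : n.-tuple R) : R := Num.sqrt (\sum_(i < n) tnth a i ^+ 2).

(* [iter_int I n f] integrates f : n.-tuple T -> \bar R against the product of n
   independent copies of the law whose integral functional is I (Tonelli order). *)
Fixpoint iter_int {T : Type} (I : (T -> \bar R) -> \bar R) (n : nat) :
    (n.-tuple T -> \bar R) -> \bar R :=
  match n with
  | 0 => fun f => f [tuple]
  | n'.+1 => fun f => I (fun x => iter_int I (fun t : n'.-tuple T => f [tuple of x :: t]))
  end.
Arguments iter_int {T} I n f.

(* integral against N(0, s^2) on R (s = standard deviation) *)
Definition gauss_int (s : R) (f : R -> \bar R) : \bar R :=
  (\int[normal_prob 0 s]_x f x)%E.

Definition gaussvec_int (s : R) (n : nat) : (n.-tuple R -> \bar R) -> \bar R :=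
  iter_int (gauss_int s) n.
Arguments gaussvec_int s n f : clear implicits.

Definition gauss_mech_prob (k : nat) (sigma : R) (y : k.-tuple R)
    (E : set (k.-tuple R)) : \bar R :=
  gaussvec_int sigma k (fun w => (\1_E (tadd y w) : R)%:E).

(* ---------- the projection matrix P (d x k), stored as d rows in R^k ---------- *)
Definition projT (d k : nat) (P : d.-tuple (k.-tuple R)) (v : d.-tuple R) : k.-tuple R :=
  [tuple \sum_(i < d) tnth v i * tnth (tnth P i) j | j < k].

Definition gaussmx_int (d k : nat) (f : d.-tuple (k.-tuple R) -> \bar R) : \bar R :=
  iter_int (gaussvec_int (Num.sqrt (k%:R^-1)) k) d f.

Definition alg_prob {X : Type} (d k : nat) (z : X -> d.-tuple R) (sigma : R)
    (D : seq X) (E : set (k.-tuple R)) : \bar R :=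
  gaussmx_int (fun P : d.-tuple (k.-tuple R) =>
    gauss_mech_prob sigma (\big[@tadd k/tzero k]_(x <- D) projT P (z x)) E).

Definition DP_for {D : Type} {k : nat} (nbr : D -> D -> Prop)
    (prob : D -> set (k.-tuple R) -> \bar R) (eps delta : R) : Prop :=
  forall D1 D2, nbr D1 D2 -> forall E : set (k.-tuple R), measurable E ->
    (prob D1 E <= (expR eps)%:E * prob D2 E + delta%:E)%E.

Definition DP_sensitivity {k : nat} (prob : k.-tuple R -> set (k.-tuple R) -> \bar R)
    (Ct eps delta : R) : Prop :=
  forall y y' : k.-tuple R, tnorm2 (tsub y y') <= Ct ->
  forall E : set (k.-tuple R), measurable E ->
    (prob y E <= (expR eps)%:E * prob y' E + delta%:E)%E.

Definition gamma_dens (K theta : R) (x : R) : R :=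
  powR x (K - 1) * expR (- x / theta).

Definition gamma_cdf (K theta t : R) : \bar R :=
  ((\int[lebesgue_measure]_(x in `[0%R, t]%classic) (gamma_dens K theta x)%:E) /
   (\int[lebesgue_measure]_(x in `[0%R, +oo[%classic) (gamma_dens K theta x)%:E))%E.

End DPdefs.

Definition nbr_S {X : Type} (D1 D2 : seq X) : Prop :=
  exists (s1 s2 : seq X) (x y : X), x <> y /\ D1 = s1 ++ x :: s2 /\ D2 = s1 ++ y :: s2.

Definition nbr_R {X : Type} (D1 D2 : seq X) : Prop :=
  exists (s1 s2 : seq X) (x : X),
    (D1 = s1 ++ x :: s2 /\ D2 = s1 ++ s2) \/ (D1 = s1 ++ s2 /\ D2 = s1 ++ x :: s2).

(* Main.v *)
(* Write v for the difference of the embeddings of the records on which the two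
   datasets differ, so that the projected sums differ by P^T v with |v| <= C.
   Where |P^T v| <= Ct the Gaussian mechanism is (eps, delta)-DP, and elsewhere
   every probability is at most 1; integrating over P, it remains to bound
   Pr(|P^T v| > Ct) by delta'.
   By rotation invariance of the Gaussian law, P^T v is distributed as |v| w, where
   w has k independent N(0, 1/k) entries, so that |P^T v|^2 is dominated by C^2 |w|^2.
   The law of C^2 |w|^2 is identified with the Gamma law without computing any
   constant: against the weight exp(|w|^2 / 2s^2) the Gaussian measure is a
   multiple of Lebesgue measure, so the weighted mass of {C^2 |w|^2 <= t} is
   homogeneous of degree k/2 in t, exactly as the integral of x^(k/2 - 1) over
   [0, t] is.  Writing exp(-x / theta) as the probability that an exponential
   variable exceeds x removes the weight on both sides by Tonelli's theorem, and
   the constant of proportionality cancels in the quotient defining the Gamma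
   distribution function. *)
Require Import Defs.
From HB Require Import structures.
From mathcomp Require Import all_boot all_order all_algebra.
From mathcomp Require Import all_classical all_reals all_analysis.
From mathcomp Require Import normal_distribution.
From mathcomp Require Import exponential_distribution measurable_realfun.
From mathcomp Require Import ring lra.
Import Order.TTheory GRing.Theory Num.Theory.
Local Open Scope classical_set_scope.
Local Open Scope ring_scope.

Set Implicit Arguments.
Unset Strict Implicit.

(** * Integration over tuples *)

Section tuple_integration.
Context {R : realType}.
Local Open Scope ereal_scope.

(** The iterated functionals accept arbitrary functions. Agreement with a measure is asked for only
    on nonnegative measurable integrands, which is where Tonelli's theorem applies. *)
Definition integrates (dT : measure_display) (T : measurableType dT)
    (I : (T -> \bar R) -> \bar R) (P : probability T R) :=
  forall f : T -> \bar R, measurable_fun setT f -> (forall x, 0 <= f x) ->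
  I f = \int[P]_x f x.

(** By induction, starting from the Dirac mass at the empty tuple: the measure on longer tuples is
    the image of a product measure under [cons], and Tonelli turns its integral into the iterated
    one. *)
Lemma iter_int_integrates (dT : measure_display) (T : measurableType dT)
    (I : (T -> \bar R) -> \bar R) (P : probability T R) n :
  integrates I P ->
  exists Q : probability (n.-tuple T) R, integrates (@iter_int R T I n) Q.
Proof.
move=> IP; elim: n => [|n [Q IQ]].
  exists (dirac ([tuple] : 0.-tuple T)) => f mf f0 /=.
  by rewrite integral_dirac// diracT mul1e.
have mc : measurable_fun setT (fun z : T * n.-tuple T => [tuple of z.1 :: z.2]).
  exact: measurable_cons.
pose c : {mfun (T * n.-tuple T)%type >-> (n.+1.-tuple T)} :=
  HB.pack (fun z : T * n.-tuple T => [tuple of z.1 :: z.2])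
    (isMeasurableFun.Build _ _ _ _ _ mc).
exists (distribution (P \x Q) c) => f mf f0 /=.
rewrite ge0_integral_distribution//.
have mfc : measurable_fun setT (f \o c) by exact: measurableT_comp.
rewrite (fubini_tonelli1 (f \o c))//=.
rewrite -IP; last 2 first.
- by apply: measurable_fun_fubini_tonelli_F => //= x; exact: f0.
- by move=> x; apply: integral_ge0 => y _; exact: f0.
congr I; apply/funext => x; rewrite IQ//=.
by apply: (measurableT_comp mf) => /=; exact: measurable_cons.
Qed.
End tuple_integration.

Section integrates_theory.
Context {R : realType} (d1 d2 : measure_display).
Context (T1 : measurableType d1) (T2 : measurableType d2).
Context (I : (T1 -> \bar R) -> \bar R) (P : probability T1 R).
Context (J : (T2 -> \bar R) -> \bar R) (Q : probability T2 R).
Hypotheses (IP : integrates I P) (JQ : integrates J Q).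
Local Open Scope ereal_scope.

Lemma integrates_ge0 (f : T1 -> \bar R) :
  measurable_fun setT f -> (forall x, 0 <= f x) -> 0 <= I f.
Proof. by move=> mf f0; rewrite IP//; exact: integral_ge0. Qed.

Lemma integrates_cst (c : \bar R) : 0 <= c -> I (fun=> c) = c.
Proof. by move=> c0; rewrite IP// integral_cst//= probability_setT mule1. Qed.

Lemma integratesZl (c : \bar R) (f : T1 -> \bar R) :
  0 <= c -> measurable_fun setT f -> (forall x, 0 <= f x) ->
  I (fun x => c * f x) = c * I f.
Proof.
move=> c0 mf f0; rewrite !IP//; first by rewrite ge0_integralZl.
- exact: emeasurable_funM.
- by move=> x; rewrite mule_ge0.
Qed.

Lemma integratesD (f g : T1 -> \bar R) :
  measurable_fun setT f -> (forall x, 0 <= f x) ->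
  measurable_fun setT g -> (forall x, 0 <= g x) ->
  I (fun x => f x + g x) = I f + I g.
Proof.
move=> mf f0 mg g0; rewrite !IP//; first by rewrite ge0_integralD.
- exact: emeasurable_funD.
- by move=> x; rewrite adde_ge0.
Qed.

Lemma le_integrates (f g : T1 -> \bar R) :
  measurable_fun setT f -> (forall x, 0 <= f x) -> measurable_fun setT g ->
  (forall x, f x <= g x) -> I f <= I g.
Proof.
move=> mf f0 mg fg; rewrite !IP//; first exact: ge0_le_integral.
by move=> x; exact: le_trans (f0 x) (fg x).
Qed.

Lemma measurable_integrates (k : T1 * T2 -> \bar R) :
  measurable_fun setT k -> (forall z, 0 <= k z) ->
  measurable_fun setT (fun x => J (fun y => k (x, y))).
Proof.
move=> mk k0.
rewrite (_ : (fun _ => _) = fun x => \int[Q]_y k (x, y)).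
  exact: measurable_fun_fubini_tonelli_F.
apply/funext => x; apply: JQ => //.
exact: measurableT_comp.
Qed.

Lemma integrates_swap (k : T1 * T2 -> \bar R) :
  measurable_fun setT k -> (forall z, 0 <= k z) ->
  I (fun x => J (fun y => k (x, y))) = J (fun y => I (fun x => k (x, y))).
Proof.
move=> mk k0.
have JE x : J (fun y => k (x, y)) = \int[Q]_y k (x, y).
  by apply: JQ => //; exact: measurableT_comp.
have IE y : I (fun x => k (x, y)) = \int[P]_x k (x, y).
  by apply: IP => //; exact: measurableT_comp.
under eq_fun do rewrite JE.
under [in RHS]eq_fun do rewrite IE.
rewrite IP; last 2 first.
- exact: measurable_fun_fubini_tonelli_F.
- by move=> x; exact: integral_ge0.
rewrite JQ; last 2 first.
- exact: measurable_fun_fubini_tonelli_G.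
- by move=> x; exact: integral_ge0.
exact: (fubini_tonelli k).
Qed.

End integrates_theory.

(** * Vectors as tuples: coordinates, norms and measurability *)

Section tuple_ops.
Context {R : realType}.

Lemma tadd_cons n (x y : R) (t u : n.-tuple R) :
  tadd [tuple of x :: t] [tuple of y :: u] = [tuple of (x + y) :: tadd t u].
Proof.
apply: eq_from_tnth => i; rewrite tnth_mktuple.
by case: (unliftP ord0 i) => [j ->|->]; rewrite ?tnthS// tnth_mktuple.
Qed.

Lemma tscale_cons n (c x : R) (t : n.-tuple R) :
  tscale c [tuple of x :: t] = [tuple of (c * x) :: tscale c t].
Proof.
apply: eq_from_tnth => i; rewrite tnth_mktuple.
by case: (unliftP ord0 i) => [j ->|->]; rewrite ?tnthS// tnth_mktuple.
Qed.

Lemma projT_cons d k (w : k.-tuple R) (P : d.-tuple (k.-tuple R)) (a : R)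
    (v : d.-tuple R) :
  projT [tuple of w :: P] [tuple of a :: v] = tadd (tscale a w) (projT P v).
Proof.
apply: eq_from_tnth => i; rewrite !tnth_mktuple big_ord_recl !tnth0.
by congr (_ + _); apply: eq_bigr => j _; rewrite !tnthS.
Qed.

Lemma sqnorm_cons n (x : R) (t : n.-tuple R) :
  \sum_(i < n.+1) tnth [tuple of x :: t] i ^+ 2 =
  x ^+ 2 + \sum_(i < n) tnth t i ^+ 2.
Proof.
rewrite big_ord_recl tnth0; congr (_ + _).
by apply: eq_bigr => i _; rewrite tnthS.
Qed.

Lemma tnorm2_cons n (x : R) (t : n.-tuple R) :
  tnorm2 [tuple of x :: t] = Num.sqrt (x ^+ 2 + tnorm2 t ^+ 2).
Proof.
rewrite /tnorm2 sqr_sqrtr ?sqnorm_cons//.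
by apply: sumr_ge0 => i _; exact: sqr_ge0.
Qed.

Context (dT : measure_display) (T : measurableType dT).

Lemma measurable_tadd n (f g : T -> n.-tuple R) :
  measurable_fun setT f -> measurable_fun setT g ->
  measurable_fun setT (fun x => tadd (f x) (g x)).
Proof.
move=> mf mg; apply/measurable_fun_tnthP => i.
rewrite (_ : _ \o _ = fun x => tnth (f x) i + tnth (g x) i); last first.
  by apply/funext => x /=; rewrite tnth_mktuple.
by apply: measurable_funD; apply: (measurableT_comp (measurable_tnth i)).
Qed.

Lemma measurable_tscale n (c : R) (f : T -> n.-tuple R) :
  measurable_fun setT f -> measurable_fun setT (fun x => tscale c (f x)).
Proof.
move=> mf; apply/measurable_fun_tnthP => i.
rewrite (_ : _ \o _ = fun x => c * tnth (f x) i); last first.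
  by apply/funext => x /=; rewrite tnth_mktuple.
by apply: measurable_funM => //; apply: (measurableT_comp (measurable_tnth i)).
Qed.

Lemma measurable_sqnorm n (f : T -> n.-tuple R) :
  measurable_fun setT f ->
  measurable_fun setT (fun x => \sum_(i < n) tnth (f x) i ^+ 2).
Proof.
move=> mf; apply: measurable_sum => i; apply: measurable_funX.
exact: (measurableT_comp (measurable_tnth i)).
Qed.

End tuple_ops.

Section tuple_norm.
Context {R : realType}.

Lemma tnorm2_le n (a : n.-tuple R) (c : R) : 0 <= c ->
  (tnorm2 a <= c) = (\sum_(i < n) tnth a i ^+ 2 <= c ^+ 2).
Proof.
move=> c0; rewrite -ler_sqr ?nnegrE// ?sqrtr_ge0// sqr_sqrtr//.
by apply: sumr_ge0 => i _; exact: sqr_ge0.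
Qed.

Lemma sqnorm_tscale n (c : R) (w : n.-tuple R) :
  \sum_(i < n) tnth (tscale c w) i ^+ 2 = c ^+ 2 * \sum_(i < n) tnth w i ^+ 2.
Proof.
by rewrite mulr_sumr; apply: eq_bigr => i _; rewrite tnth_mktuple exprMn.
Qed.

(** With equal radii c / 2, the coordinatewise bound (x - y)^2 <= 2 x^2 + 2 y^2 already sums to c^2,
    so the general triangle inequality is avoided. *)
Lemma tnorm2_tsub_le n (a b : n.-tuple R) (c : R) : 0 <= c ->
  tnorm2 a <= c / 2 -> tnorm2 b <= c / 2 -> tnorm2 (tsub a b) <= c.
Proof.
move=> c0; rewrite !tnorm2_le ?divr_ge0// => ha hb.
apply: (@le_trans _ _ (2 * \sum_(i < n) tnth a i ^+ 2 + 2 * \sum_(i < n) tnth b i ^+ 2)).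
  rewrite !mulr_sumr -big_split/=; apply: ler_sum => i _; rewrite tnth_mktuple.
  have := sqr_ge0 (tnth a i + tnth b i).
  set x := tnth a i; set y := tnth b i => ?; nra.
by rewrite exprMn exprVn in ha hb; lra.
Qed.

Lemma tnth_bigtadd n (X : Type) (D : seq X) (F : X -> n.-tuple R) j :
  tnth (\big[@tadd R n/tzero n]_(x <- D) F x) j = \sum_(x <- D) tnth (F x) j.
Proof.
elim: D => [|x D IH]; first by rewrite !big_nil tnth_mktuple.
by rewrite !big_cons tnth_mktuple IH.
Qed.

Lemma tnth_projT_tsub d k (P : d.-tuple (k.-tuple R)) (a b : d.-tuple R) j :
  tnth (projT P (tsub a b)) j = tnth (projT P a) j - tnth (projT P b) j.
Proof.
rewrite !tnth_mktuple -sumrB; apply: eq_bigr => i _.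
by rewrite tnth_mktuple mulrBl.
Qed.

Lemma measurable_projT d k (v : d.-tuple R) :
  measurable_fun setT (fun P : d.-tuple (k.-tuple R) => projT P v).
Proof.
apply/measurable_fun_tnthP => j.
rewrite (_ : _ \o _ = fun P : d.-tuple (k.-tuple R) =>
    \sum_(i < d) tnth v i * tnth (tnth P i) j); last first.
  by apply/funext => P /=; rewrite tnth_mktuple.
apply: measurable_sum => i; apply: measurable_funM => //.
exact: (measurableT_comp (measurable_tnth j) (measurable_tnth i)).
Qed.

Lemma measurable_bigtadd (dT : measure_display) (T : measurableType dT) n
    (X : Type) (D : seq X) (F : X -> T -> n.-tuple R) :
  (forall x, measurable_fun setT (F x)) ->
  measurable_fun setT (fun t => \big[@tadd R n/tzero n]_(x <- D) F x t).
Proof.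
move=> mF; elim: D => [|x D IH].
  by under eq_fun do rewrite big_nil; exact: measurable_cst.
by under eq_fun do rewrite big_cons; exact: measurable_tadd.
Qed.

End tuple_norm.

(** * Densities and affine changes of variables *)

Section density.
Context (dT : measure_display) (T : measurableType dT) (R : realType).
Local Open Scope ereal_scope.
Import HBNNSimple.

(** Monotone convergence along simple functions increasing to [f], applied on both sides, reduces
    the claim to a simple function, where it is [nuE] on each level set. *)
Lemma ge0_integral_density (m nu : {measure set T -> \bar R}) (g : T -> R)
    (f : T -> \bar R) :
  measurable_fun setT g -> (forall x, (0 <= g x)%R) ->
  (forall A, measurable A -> nu A = \int[m]_(x in A) (g x)%:E) ->
  measurable_fun setT f -> (forall x, 0 <= f x) ->
  \int[nu]_x f x = \int[m]_x (f x * (g x)%:E).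
Proof.
move=> mg g0 nuE mf f0.
pose h := nnsfun_approx measurableT mf.
have hf x : limn (fun n => (h n x)%:E) = f x.
  by apply/cvg_lim => //; exact: cvg_nnsfun_approx.
have ndh x : {homo (fun n => (h n x)%:E) : a b / (a <= b)%N >-> a <= b}.
  by move=> a b ab; rewrite lee_fin; exact/lefP/nd_nnsfun_approx.
have mh n : measurable_fun setT (fun x => (h n x)%:E).
  exact/measurable_EFinP/measurable_funP.
transitivity (limn (fun n => \int[nu]_x (h n x)%:E)).
  rewrite -monotone_convergence//.
    by apply: eq_integral => x _; rewrite hf.
  by move=> n x _; rewrite lee_fin.
transitivity (limn (fun n => \int[m]_x ((h n x)%:E * (g x)%:E))); last first.
  rewrite -monotone_convergence//.
  - apply: eq_integral => x _; rewrite -hf; apply/cvg_lim => //.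
    under eq_fun do rewrite muleC.
    rewrite muleC; apply: cvgeZl => //.
    by rewrite hf; exact: cvg_nnsfun_approx.
  - by move=> n; apply: emeasurable_funM => //; exact/measurable_EFinP.
  - by move=> n x _; rewrite mule_ge0// lee_fin.
  - by move=> x _ a b ab; rewrite lee_wpmul2r// ?lee_fin//; exact/lefP/nd_nnsfun_approx.
congr (limn _); apply/funext => n.
rewrite integralT_nnsfun sintegralE.
under [RHS]eq_integral => x _.
  rewrite fimfunE -fsumEFin// ge0_mule_fsuml; last first.
    by move=> y; rewrite nnfun_muleindic_ge0.
  over.
rewrite /= ge0_integral_fsum//; last 2 first.
- move=> y; apply: emeasurable_funM; last exact/measurable_EFinP.
  by apply/measurable_EFinP/measurable_funM.
- by move=> y x _; rewrite mule_ge0 ?nnfun_muleindic_ge0// lee_fin.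
apply: eq_fsbigr => y _; rewrite nuE//.
(* A nonnegative simple function takes no negative value, so for y < 0 both terms vanish. *)
have [y0|y0] := leP 0%R y; last first.
  by rewrite preimage_nnfun0// integral_set0 mule0 indic0 integral0_eq// => x _;
     rewrite mulr0 mul0e.
under [RHS]eq_integral do rewrite EFinM -muleA.
rewrite ge0_integralZl//; last 2 first.
- by apply: emeasurable_funM; exact/measurable_EFinP.
- by move=> x _; rewrite mule_ge0 ?lee_fin.
congr *%E; rewrite [LHS]integral_mkcond; apply: eq_integral => x _.
by rewrite patchE indicE; case: ifP => _; rewrite ?mul1e ?mul0e.
Qed.
End density.

Section lebesgue_affine.
Context {R : realType}.
Local Open Scope ereal_scope.
Local Notation mu := (@lebesgue_measure R).

(** The image of Lebesgue measure under a translation gives each half-open interval its length, so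
    uniqueness identifies it with Lebesgue measure. The scaling lemma below follows the same
    pattern. *)
Lemma ge0_integral_shift (f : R -> \bar R) (c : R) :
  measurable_fun setT f -> (forall x, 0 <= f x) ->
  \int[mu]_x f (x + c)%R = \int[mu]_x f x.
Proof.
move=> mf f0.
have mc : measurable_fun setT ((fun x => x + c)%R : R -> measurableTypeR R).
  by apply: measurable_funD.
transitivity (\int[pushforward mu ((fun x => x + c)%R : R -> measurableTypeR R)]_x f x).
  by rewrite ge0_integral_pushforward.
apply: eq_measure_integral => A mA _.
apply/esym/lebesgue_measure_unique => //= _ [[a b]] _ <-.
rewrite /pushforward (_ : _ @^-1` _ = `](a - c)%R, (b - c)%R]%classic); last first.
  by apply/seteqP; split => x /=; rewrite !in_itv/= ltrBlDr lerBrDr.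
rewrite !lebesgue_measure_itv/= !lte_fin ltrD2r; case: ifP => // _.
by rewrite -!EFinB; congr EFin; ring.
Qed.

Lemma ge0_integral_scale_pos (f : R -> \bar R) (c : R) :
  (0 < c)%R -> measurable_fun setT f -> (forall x, 0 <= f x) ->
  c%:E * \int[mu]_x f (c * x)%R = \int[mu]_x f x.
Proof.
move=> c0 mf f0.
have mc : measurable_fun setT ((fun x => c * x)%R : R -> measurableTypeR R).
  by apply: measurable_funM.
transitivity (c%:E *
    \int[pushforward mu ((fun x => c * x)%R : R -> measurableTypeR R)]_x f x).
  by rewrite ge0_integral_pushforward.
(* [mscale] takes a bundled nonnegative number; in this form the factor c can be absorbed into the
   measure. *)
have -> : c = (NngNum (ltW c0))%:num by [].
rewrite -ge0_integral_mscale//.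
apply: eq_measure_integral => A mA _.
apply/esym/lebesgue_measure_unique => //= _ [[a b]] _ <-.
rewrite /mscale/= /pushforward
  (_ : _ @^-1` _ = `](a / c)%R, (b / c)%R]%classic); last first.
  by apply/seteqP; split => x /=; rewrite !in_itv/= ltr_pdivrMr// ler_pdivlMr// mulrC.
rewrite !lebesgue_measure_itv/= !lte_fin ltr_pM2r ?invr_gt0//.
case: ifP => // _; last by rewrite mule0.
by rewrite -!EFinB -EFinM; congr EFin; field; rewrite gt_eqF.
Qed.

Lemma ge0_integral_opp (f : R -> \bar R) :
  measurable_fun setT f -> (forall x, 0 <= f x) ->
  \int[mu]_x f (- x)%R = \int[mu]_x f x.
Proof.
move=> mf f0.
transitivity (\int[pushforward mu (-%R : R -> measurableTypeR R)]_x f x).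
  by rewrite ge0_integral_pushforward.
by apply: eq_measure_integral => A mA _; exact: lebesgue_measureN.
Qed.

Lemma ge0_integral_scale (f : R -> \bar R) (c : R) :
  (c != 0)%R -> measurable_fun setT f -> (forall x, 0 <= f x) ->
  `|c|%:E * \int[mu]_x f (c * x)%R = \int[mu]_x f x.
Proof.
rewrite neq_lt => /orP[c0|c0] mf f0; last first.
  by rewrite gtr0_norm// ge0_integral_scale_pos.
rewrite ltr0_norm// -(@ge0_integral_opp f)//.
rewrite -(@ge0_integral_scale_pos (fun x => f (- x)%R) (- c)%R) ?oppr_gt0//.
  by under [in RHS]eq_integral do rewrite mulNr opprK.
exact: measurableT_comp.
Qed.

End lebesgue_affine.

(** * Rotation invariance of the Gaussian law *)

Section gauss_line.
Context {R : realType}.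
Variable s : R.
Hypothesis s0 : s != 0.
Local Open Scope ereal_scope.
Local Notation mu := (@lebesgue_measure R).
Local Notation e := (normal_fun 0 s).
Local Notation peak := (normal_peak s).

Lemma gauss_intE (f : R -> \bar R) :
  measurable_fun setT f -> (forall x, 0 <= f x) ->
  gauss_int s f = peak%:E * \int[mu]_x (f x * (e x)%:E).
Proof.
move=> mf f0; rewrite /gauss_int.
rewrite (@ge0_integral_density _ _ _ mu _ (normal_pdf 0 s))//; last 2 first.
- exact: measurable_normal_pdf.
- exact: normal_pdf_ge0.
rewrite -ge0_integralZl//; last 3 first.
- apply: emeasurable_funM => //; apply/measurable_EFinP.
  exact: measurable_normal_fun.
- by move=> x _; rewrite mule_ge0// lee_fin normal_fun_ge0.
- by rewrite lee_fin normal_peak_ge0.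
by apply: eq_integral => x _; rewrite (normal_pdfE _ s0) EFinM muleCA.
Qed.

Lemma gauss_int_cst (c : \bar R) : gauss_int s (fun=> c) = c.
Proof. by rewrite /gauss_int integral_cst//= probability_setT mule1. Qed.

Lemma gauss_int_opp (f : R -> \bar R) :
  measurable_fun setT f -> (forall x, 0 <= f x) ->
  gauss_int s (fun x => f (- x)%R) = gauss_int s f.
Proof.
move=> mf f0.
have mfN : measurable_fun setT (fun x : R => f (- x)%R) by exact: measurableT_comp.
have mfe : measurable_fun setT (fun x : R => f x * (e x)%:E).
  apply: emeasurable_funM => //; apply/measurable_EFinP.
  exact: measurable_normal_fun.
have fe0 (x : R) : 0 <= f x * (e x)%:E.
  by rewrite mule_ge0// lee_fin normal_fun_ge0.
rewrite (gauss_intE mfN (fun x => f0 _)) (gauss_intE mf f0); congr *%E.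
rewrite -[RHS](ge0_integral_opp mfe fe0).
by apply: eq_integral => x _; rewrite /normal_fun !subr0 sqrrN.
Qed.

(** Substituting u = a x + b y for y, exchanging the integrals and completing the square in x leaves
    a Gaussian in u / r. The constant [K] does not depend on [g], so it need not be evaluated
    here. *)
Lemma gauss_int_rotate_proportional (a b : R) : (b != 0)%R ->
  exists K : \bar R, forall g : R -> \bar R,
  measurable_fun setT g -> (forall x, 0 <= g x) ->
  gauss_int s (fun x => gauss_int s (fun y => g (a * x + b * y)%R)) =
  K * gauss_int s (fun x => g (Num.sqrt (a ^+ 2 + b ^+ 2) * x)%R).
Proof.
move=> b0; set r := Num.sqrt _.
have r2 : (r ^+ 2 = a ^+ 2 + b ^+ 2)%R.
  by rewrite sqr_sqrtr// addr_ge0// sqr_ge0.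
have r0 : (0 < r)%R.
  by rewrite sqrtr_gt0 ltr_wpDl ?sqr_ge0// lt_def sqr_ge0 andbT expf_neq0.
have r20 : (a ^+ 2 + b ^+ 2 != 0)%R by rewrite -r2 expf_neq0// gt_eqF.
(* [J] is the integral over x once the square is completed. In the witness, |b|^-1 and r are the
   Jacobians of u = a x + b y and of u = r x; of the two factors [peak], the other belongs to the
   Gaussian integral on the right. *)
pose J := \int[mu]_x (normal_fun 0 s (r / b * x))%:E.
exists (peak%:E * J * (`|b|^-1 * r)%:E) => g mg g0.
have me (x : R) : measurable_fun setT (fun u : R => normal_fun 0 s ((u - a * x) / b)).
  apply: (measurableT_comp (measurable_normal_fun 0 s)).
  by apply: measurable_funM => //; exact: measurable_funB.
have mge (x : R) : measurable_fun setT (fun u : R => g u * (e ((u - a * x) / b))%:E).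
  by apply: emeasurable_funM => //; exact/measurable_EFinP.
have inner x : gauss_int s (fun y => g (a * x + b * y)%R) =
    (peak * `|b|^-1)%:E * \int[mu]_u (g u * (e ((u - a * x) / b))%:E).
  have mgl : measurable_fun setT (fun y : R => g (a * x + b * y)%R).
    by apply: measurableT_comp => //; apply: measurable_funD.
  rewrite (gauss_intE mgl (fun y => g0 _)).
  rewrite EFinM -muleA; congr *%E.
  rewrite -(@ge0_integral_shift _ (fun u => g u * _) (a * x)%R)//; last first.
  - by move=> u; rewrite mule_ge0// lee_fin normal_fun_ge0.
  rewrite -[in RHS](@ge0_integral_scale _ _ b)//; last 2 first.
  - apply: emeasurable_funM.
      by apply: measurableT_comp => //; exact: measurable_funD.
    apply/measurable_EFinP; apply: (measurableT_comp (measurable_normal_fun 0 s)).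
    apply: measurable_funM => //; apply: measurable_funB => //.
    exact: measurable_funD.
  - by move=> u; rewrite mule_ge0// lee_fin normal_fun_ge0.
  rewrite muleA -EFinM mulVf ?normr_eq0// mul1e.
  apply: eq_integral => y _; rewrite [(b * y + _)%R]addrC; congr (_ * (e _)%:E).
  by field.
under eq_fun do rewrite inner.
pose h (z : R * R) := g z.2 * (e ((z.2 - a * z.1) / b) * e z.1)%:E.
have mh : measurable_fun setT h.
  apply: emeasurable_funM; first exact: measurableT_comp.
  apply/measurable_EFinP/measurable_funM.
    apply: (measurableT_comp (measurable_normal_fun 0 s)).
    apply: measurable_funM => //; apply: measurable_funB => //.
    exact: measurable_funM.
  exact: (measurableT_comp (measurable_normal_fun 0 s)).
have h0 z : 0 <= h z by rewrite mule_ge0// lee_fin mulr_ge0// normal_fun_ge0.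
have mI : measurable_fun setT
    (fun x : R => \int[mu]_u (g u * (e ((u - a * x) / b))%:E)).
  pose k (z : R * R) := g z.2 * (e ((z.2 - a * z.1) / b))%:E.
  apply: (@measurable_fun_fubini_tonelli_F _ _ _ _ R mu k).
    apply: emeasurable_funM; first exact: measurableT_comp.
    apply/measurable_EFinP.
    apply: (measurableT_comp (measurable_normal_fun 0 s)).
    apply: measurable_funM => //; apply: measurable_funB => //.
    exact: measurable_funM.
  by move=> z; rewrite mule_ge0// lee_fin normal_fun_ge0.
have I0 (x : R) : 0 <= \int[mu]_u (g u * (e ((u - a * x) / b))%:E).
  by apply: integral_ge0 => u _; rewrite mule_ge0// lee_fin normal_fun_ge0.
have c0 : 0 <= (peak * `|b|^-1)%:E.
  by rewrite lee_fin mulr_ge0 ?normal_peak_ge0// invr_ge0.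
rewrite gauss_intE; last 2 first.
- exact: emeasurable_funM.
- by move=> x; rewrite mule_ge0.
have -> : \int[mu]_x ((peak * `|b|^-1)%:E *
      (\int[mu]_u (g u * (e ((u - a * x) / b))%:E)) * (e x)%:E) =
    (peak * `|b|^-1)%:E * \int[mu]_x \int[mu]_u h (x, u).
  rewrite -ge0_integralZl//; last 2 first.
  - exact: measurable_fun_fubini_tonelli_F.
  - by move=> x _; exact: integral_ge0.
  apply: eq_integral => x _; rewrite -muleA -ge0_integralZr//; last 3 first.
  - exact: mge.
  - by move=> u _; rewrite mule_ge0// lee_fin normal_fun_ge0.
  - by rewrite lee_fin normal_fun_ge0.
  by congr *%E; apply: eq_integral => u _; rewrite /h EFinM muleA.
have -> : \int[mu]_x \int[mu]_u h (x, u) = \int[mu]_u \int[mu]_x h (x, u).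
  exact: (@fubini_tonelli _ _ _ _ R mu mu h).
have mJ : measurable_fun setT (fun x : R => (e (r / b * x))%:E).
  apply/measurable_EFinP; apply: (measurableT_comp (measurable_normal_fun 0 s)).
  exact: measurable_funM.
have meh (u : R) : measurable_fun setT
    (fun x : R => (e (r / b * (x + (- (u * a / r ^+ 2))%R)))%:E).
  apply/measurable_EFinP; apply: (measurableT_comp (measurable_normal_fun 0 s)).
  by apply: measurable_funM => //; apply: measurable_funD.
have J0 : 0 <= J by apply: integral_ge0 => x _; rewrite lee_fin normal_fun_ge0.
(* Completing the square: x^2 + ((u - a x) / b)^2 = (r / b)^2 (x - u a / r^2)^2 + (u / r)^2. A
   translation in x then removes the dependence on u from the first term. *)
have hu u : \int[mu]_x h (x, u) = J * (g u * (e (u / r))%:E).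
  rewrite /J -(@ge0_integral_shift _ (fun x => (e (r / b * x))%:E)
    (- (u * a / r ^+ 2))%R)//; last first.
    by move=> x; rewrite lee_fin normal_fun_ge0.
  rewrite -ge0_integralZr//; last 3 first.
  - exact: meh.
  - by move=> x _; rewrite lee_fin normal_fun_ge0.
  - by rewrite mule_ge0// lee_fin normal_fun_ge0.
  apply: eq_integral => x _; rewrite /h/= [RHS]muleC -[RHS]muleA; congr *%E.
  rewrite -!EFinM; congr EFin; rewrite /normal_fun !subr0 -!expRD; congr expR.
  rewrite !exprMn !exprVn r2.
  by field; rewrite s0 b0 r20.
have -> : \int[mu]_u \int[mu]_x h (x, u) =
    \int[mu]_u (J * (g u * (e (u / r))%:E)).
  by apply: eq_integral => u _; exact: hu.
have mer : measurable_fun setT (fun u : R => g u * (e (u / r))%:E).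
  apply: emeasurable_funM => //; apply/measurable_EFinP.
  apply: (measurableT_comp (measurable_normal_fun 0 s)).
  exact: measurable_funM.
have er0 (u : R) : 0 <= g u * (e (u / r))%:E.
  by rewrite mule_ge0// lee_fin normal_fun_ge0.
rewrite ge0_integralZl// -(ge0_integral_scale_pos r0 mer er0).
rewrite gauss_intE//; last by apply: measurableT_comp => //; exact: measurable_funM.
have -> : \int[mu]_x (g (r * x)%R * (e (r * x / r))%:E) =
    \int[mu]_x (g (r * x)%R * (e x)%:E).
  by apply: eq_integral => u _; rewrite mulrAC divff ?gt_eqF// mul1r.
rewrite !EFinM !muleA; congr (_ * _).
rewrite -!muleA; congr (_ * _).
rewrite [RHS]muleC -!muleA muleC -!muleA; congr (_ * _).
by rewrite muleCA; congr (_ * _); rewrite muleC.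
Qed.
(** For b nonzero, the constant of proportionality is found by testing at g = 1, where both
    integrals equal 1. *)
Lemma gauss_int_rotate (a b : R) (g : R -> \bar R) :
  measurable_fun setT g -> (forall x, 0 <= g x) ->
  gauss_int s (fun x => gauss_int s (fun y => g (a * x + b * y)%R)) =
  gauss_int s (fun x => g (Num.sqrt (a ^+ 2 + b ^+ 2) * x)%R).
Proof.
move=> mg g0; have [->|b0] := eqVneq b 0%R.
  (* For b = 0 the radius is |a|, so a negative a calls for the symmetry of the Gaussian law. *)
  under eq_fun do under eq_fun do rewrite mul0r addr0.
  under eq_fun do rewrite gauss_int_cst.
  rewrite expr0n/= addr0 sqrtr_sqr.
  have [a0|a0] := ger0P a; first by [].
  rewrite -[RHS]gauss_int_opp//.
    by congr gauss_int; apply/funext => x; rewrite mulrNN.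
  by apply: measurableT_comp => //; exact: measurable_funM.
have [K HK] := gauss_int_rotate_proportional a b0.
rewrite HK//; suff -> : K = 1 by rewrite mul1e.
have := HK (cst 1) (measurable_cst _) (fun=> lee01).
by rewrite /= !gauss_int_cst mule1.
Qed.

(** The weight cancels [normal_fun] exactly, so each weighted integral is [peak] times a Lebesgue
    integral, and only the change of variables x -> c x remains. *)
Lemma gauss_int_scale (c : R) (f : R -> \bar R) : (0 < c)%R ->
  measurable_fun setT f -> (forall x, 0 <= f x) ->
  c%:E * gauss_int s (fun x => (expR (x ^+ 2 / (s ^+ 2 *+ 2)))%:E * f (c * x)%R) =
  gauss_int s (fun x => (expR (x ^+ 2 / (s ^+ 2 *+ 2)))%:E * f x).
Proof.
move=> c0 mf f0.
have mE : measurable_fun setT (fun x : R => (expR (x ^+ 2 / (s ^+ 2 *+ 2)))%:E).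
  by apply/measurable_EFinP; apply: measurableT_comp => //; exact: measurable_funM.
have mfc : measurable_fun setT (fun x : R => f (c * x)%R).
  by apply: measurableT_comp => //; exact: measurable_funM.
have E (h : R -> \bar R) : measurable_fun setT h -> (forall x, 0 <= h x) ->
    gauss_int s (fun x => (expR (x ^+ 2 / (s ^+ 2 *+ 2)))%:E * h x) =
    peak%:E * \int[mu]_x h x.
  move=> mh h0; rewrite gauss_intE.
  - congr *%E; apply: eq_integral => x _.
    rewrite muleAC -EFinM /normal_fun subr0 -expRD mulNr subrr expR0.
    by rewrite mul1e.
  - exact: emeasurable_funM.
  - by move=> x; rewrite mule_ge0// lee_fin expR_ge0.
by rewrite !E// muleCA ge0_integral_scale_pos.
Qed.

End gauss_line.

(** * Gaussian vectors: rotation, projection and scaling *)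

Section gauss_vectors.
Context {R : realType}.
Variable s : R.
Hypothesis s0 : s != 0.
Local Open Scope ereal_scope.

(* [normal_prob] lives on [measurableTypeR R], whose display differs from that of
   the canonical measurable structure of [R]; the identity transports it. *)
Lemma gauss_integrates : exists Q : probability R R, integrates (@gauss_int R s) Q.
Proof.
have mi : measurable_fun setT (fun x : measurableTypeR R => x : R) by [].
pose c : {mfun measurableTypeR R >-> R} :=
  HB.pack (fun x : measurableTypeR R => x : R)
    (isMeasurableFun.Build _ _ _ _ _ mi).
exists (distribution (normal_prob 0 s) c) => f mf f0.
by rewrite ge0_integral_distribution.
Qed.

Lemma gaussvec_integrates n :
  exists Q : probability (n.-tuple R) R, integrates (@gaussvec_int R s n) Q.
Proof.
have [N IN] := gauss_integrates.
exact: (iter_int_integrates n IN).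
Qed.

Lemma gaussvec_int_rotate n (a b : R) (g : n.-tuple R -> \bar R) :
  measurable_fun setT g -> (forall x, 0 <= g x) ->
  gaussvec_int s (fun w => gaussvec_int s (fun u => g (tadd (tscale a w) (tscale b u)))) =
  gaussvec_int s (fun w => g (tscale (Num.sqrt (a ^+ 2 + b ^+ 2)) w)).
Proof.
elim: n g => [|n IH] g mg g0.
  by rewrite /gaussvec_int/=; congr g; apply: eq_from_tnth => -[].
have [Q IQ] := gaussvec_integrates n.
have [N IN] := gauss_integrates.
have mgc (c : R) : measurable_fun setT (fun t : n.-tuple R => g [tuple of c :: t]).
  by apply: (measurableT_comp mg); exact: measurable_cons.
rewrite {1}/gaussvec_int /=.
(* The iterated integrals run over x, w, y, u, with x and y the first coordinates. Exchanging w and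
   y brings the two first coordinates together and the two tails together. *)
transitivity (gauss_int s (fun x => gauss_int s (fun y =>
    gaussvec_int s (fun w : n.-tuple R => gaussvec_int s (fun u : n.-tuple R =>
      g [tuple of (a * x + b * y)%R :: tadd (tscale a w) (tscale b u)]))))).
  congr gauss_int; apply/funext => x.
  pose h (z : (n.-tuple R * R) * n.-tuple R) :=
    g [tuple of (a * x + b * z.1.2)%R :: tadd (tscale a z.1.1) (tscale b z.2)].
  have mh : measurable_fun setT h.
    apply: (measurableT_comp mg); apply: measurable_cons.
      apply: measurable_funD => //; apply: measurable_funM => //.
      exact: measurableT_comp.
    apply: measurable_tadd; apply: measurable_tscale => //.
    exact: measurableT_comp.
  have := integrates_swap IQ IN
    (k := fun z => gaussvec_int s (fun u : n.-tuple R => h (z, u))).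
  move=> <-.
  - congr iter_int; apply/funext => w; congr gauss_int; apply/funext => y.
    congr iter_int; apply/funext => u; congr g.
    by rewrite !tscale_cons tadd_cons.
  - by apply: (measurable_integrates IQ) => // z; exact: g0.
  - move=> z; apply: (integrates_ge0 IQ) => // [|u]; last exact: g0.
    exact: measurableT_comp.
under eq_fun do under eq_fun do rewrite (IH (fun t => g [tuple of _ :: t]))//.
(* The induction hypothesis has merged the tails; as a function of the first coordinate, the
   remaining integral is [H], to which the one-dimensional rotation applies. *)
pose H (c : R) := gaussvec_int s (fun w : n.-tuple R =>
  g [tuple of c :: tscale (Num.sqrt (a ^+ 2 + b ^+ 2)) w]).
rewrite (gauss_int_rotate s0 a b (g := H)).
- congr gauss_int; apply/funext => x; congr iter_int; apply/funext => t.
  by rewrite tscale_cons.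
- pose h (z : R * n.-tuple R) :=
    g [tuple of z.1 :: tscale (Num.sqrt (a ^+ 2 + b ^+ 2)) z.2].
  apply: (measurable_integrates IQ (k := h)) => [|z]; last exact: g0.
  apply: (measurableT_comp mg); apply: measurable_cons => //.
  exact: measurable_tscale.
- move=> c; apply: (integrates_ge0 IQ) => //.
  by apply: (measurableT_comp (mgc c)); exact: measurable_tscale.
Qed.

(** Induction on the rows. With v = (a, v') and first row w, the projection is a w + P'^T v'; the
    second term has the law of |v'| u by induction, and rotation invariance merges the two into
    sqrt(a^2 + |v'|^2) w. *)
Lemma gaussmx_int_projT d k (v : d.-tuple R) (g : k.-tuple R -> \bar R) :
  measurable_fun setT g -> (forall x, 0 <= g x) ->
  iter_int (@gaussvec_int R s k) (fun P => g (projT P v)) =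
  gaussvec_int s (fun w => g (tscale (tnorm2 v) w)).
Proof.
move=> mg g0; elim: d v g mg g0 => [|d IH] v g mg g0.
  have [Q IQ] := gaussvec_integrates k.
  rewrite /= -[LHS](integrates_cst IQ)//; congr iter_int; apply/funext => w.
  congr g; apply: eq_from_tnth => i.
  by rewrite !tnth_mktuple big_ord0 /tnorm2 big_ord0 sqrtr0 mul0r.
rewrite (tuple_eta v) /= tnorm2_cons.
rewrite -gaussvec_int_rotate//; congr iter_int; apply/funext => w.
rewrite -(IH _ (fun u => g (tadd (tscale (thead v) w) u)))//.
  by congr iter_int; apply/funext => P; rewrite projT_cons.
by apply: (measurableT_comp mg); exact: measurable_tadd.
Qed.

(** The weight factors over the coordinates, and each coordinate contributes one factor c by
    [gauss_int_scale]. *)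
Lemma gaussvec_int_scale n (c : R) (f : n.-tuple R -> \bar R) : (0 < c)%R ->
  measurable_fun setT f -> (forall x, 0 <= f x) ->
  (c ^+ n)%:E * gaussvec_int s (fun w =>
    (expR ((\sum_(i < n) tnth w i ^+ 2) / (s ^+ 2 *+ 2)))%:E * f (tscale c w)) =
  gaussvec_int s (fun w =>
    (expR ((\sum_(i < n) tnth w i ^+ 2) / (s ^+ 2 *+ 2)))%:E * f w).
Proof.
move=> c0; elim: n f => [|n IH] f mf f0.
  rewrite expr0 mul1e /gaussvec_int/=; congr (_ * f _).
  by apply: eq_from_tnth => -[].
have [Q IQ] := gaussvec_integrates n.
have [N IN] := gauss_integrates.
pose E m (w : m.-tuple R) := expR ((\sum_(i < m) tnth w i ^+ 2) / (s ^+ 2 *+ 2)).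
have mE m : measurable_fun setT (@E m).
  apply: measurableT_comp => //; apply: measurable_funM => //.
  exact: measurable_sqnorm.
have E0 m w : (0 <= @E m w)%R by exact: expR_ge0.
have Econs x (w : n.-tuple R) :
    E n.+1 [tuple of x :: w] = (expR (x ^+ 2 / (s ^+ 2 *+ 2)) * E n w)%R.
  by rewrite /E sqnorm_cons mulrDl expRD.
pose K (y : R) := gaussvec_int s (fun w : n.-tuple R => (E n w)%:E * f [tuple of y :: w]).
have mk : measurable_fun setT
    (fun z : R * n.-tuple R => (E n z.2)%:E * f [tuple of z.1 :: z.2]).
  apply: emeasurable_funM.
    by apply/measurable_EFinP; exact: (measurableT_comp (mE n)).
  by apply: (measurableT_comp mf); exact: measurable_cons.
have K0 (y : R) : 0 <= K y.
  apply: (integrates_ge0 IQ); last by move=> w; rewrite mule_ge0// lee_fin.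
  apply: emeasurable_funM; first by apply/measurable_EFinP; exact: mE.
  by apply: (measurableT_comp mf); exact: measurable_cons.
have mK : measurable_fun setT K.
  by apply: (measurable_integrates IQ mk) => z; rewrite mule_ge0// lee_fin.
have pull (x : R) (h : n.-tuple R -> \bar R) : measurable_fun setT h ->
    (forall w, 0 <= h w) ->
    gaussvec_int s (fun w : n.-tuple R => (E n.+1 [tuple of x :: w])%:E * h w) =
    (expR (x ^+ 2 / (s ^+ 2 *+ 2)))%:E * gaussvec_int s (fun w => (E n w)%:E * h w).
  move=> mh h0; rewrite -(integratesZl IQ) ?lee_fin ?expR_ge0//.
  - by congr iter_int; apply/funext => w; rewrite Econs EFinM muleA.
  - by apply: emeasurable_funM => //; apply/measurable_EFinP; exact: mE.
  - by move=> w; rewrite mule_ge0// lee_fin.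
transitivity (gauss_int s (fun x =>
    (expR (x ^+ 2 / (s ^+ 2 *+ 2)))%:E * K x)); last first.
  congr gauss_int; apply/funext => x; rewrite -pull//.
  by apply: (measurableT_comp mf); exact: measurable_cons.
rewrite -(gauss_int_scale s0 c0 mK K0) exprS EFinM -muleA; congr *%E.
have mKc : measurable_fun setT (fun x : R =>
    (expR (x ^+ 2 / (s ^+ 2 *+ 2)))%:E * K (c * x)%R).
  apply: emeasurable_funM.
    by apply/measurable_EFinP; apply: measurableT_comp => //; exact: measurable_funM.
  by apply: (measurableT_comp mK); exact: measurable_funM.
have KE y : (c ^+ n)%:E * gaussvec_int s (fun w : n.-tuple R =>
    (E n w)%:E * f [tuple of y :: tscale c w]) = K y.
  apply: (IH (fun w => f [tuple of y :: w])) => //.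
  by apply: (measurableT_comp mf); exact: measurable_cons.
have cn : (c ^+ n != 0)%R by rewrite expf_neq0// gt_eqF.
(* [KE] evaluates the inner integral only together with its factor c^n, hence the inverse, which is
   cancelled once it is outside the integral. *)
have -> : gaussvec_int s (fun w : n.+1.-tuple R => (E n.+1 w)%:E * f (tscale c w)) =
    gauss_int s (fun x => ((c ^+ n)^-1)%:E *
      ((expR (x ^+ 2 / (s ^+ 2 *+ 2)))%:E * K (c * x)%R)).
  congr gauss_int; apply/funext => x.
  rewrite -KE muleCA [X in _ = _ * X]muleA -EFinM mulVf// mul1e -pull//.
    by congr iter_int; apply/funext => w; rewrite tscale_cons.
  apply: (measurableT_comp mf); apply: measurable_cons => //.
  exact: measurable_tscale.
rewrite (integratesZl IN)//.
- by rewrite muleA -EFinM divff// mul1e.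
- by rewrite lee_fin invr_ge0 exprn_ge0// ltW.
- by move=> x; rewrite mule_ge0// lee_fin expR_ge0.
Qed.
End gauss_vectors.

(** * The Gamma law of the squared norm *)

Section layer_cake.
Context {R : realType}.
Local Open Scope ereal_scope.
Local Notation mu := (@lebesgue_measure R).

(** Memorylessness: translated by a, the density on r >= 0 is multiplied by exp(- rate a), and its
    total mass is 1. *)
Lemma exponential_pdf_tail (rate a : R) : (0 < rate)%R -> (0 <= a)%R ->
  \int[mu]_r (if (a <= r)%R then exponential_pdf rate r else 0%R)%:E =
  (expR (- rate * a))%:E.
Proof.
move=> rate0 a0.
have mp := measurable_exponential_pdf rate.
have mpE : measurable_fun setT (fun r : R => (exponential_pdf rate r)%:E).
  exact/measurable_EFinP.
have p0 := exponential_pdf_ge0 (ltW rate0).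
rewrite -(@ge0_integral_shift _ _ a); last 2 first.
- apply/measurable_EFinP; apply: measurable_fun_ifT => //.
  exact: measurable_fun_ler.
- by move=> r; rewrite lee_fin; case: ifP.
rewrite -[RHS]mule1 -(integral_exponential_pdf rate0).
rewrite -ge0_integralZl ?lee_fin ?expR_ge0//; last first.
  by move=> r _; rewrite lee_fin.
apply: eq_integral => r _; rewrite lerDr; case: ifPn => [r0|].
  rewrite !exponential_pdfE ?addr_ge0// -EFinM; congr EFin.
  by rewrite mulrCA -expRD; congr (_ * expR _)%R; ring.
by rewrite -ltNge => r0; rewrite lt0_exponential_pdf// mule0.
Qed.

(** The exponential factor is the probability that an exponential variable reaches q x; Tonelli then
    integrates over the level r last. Dropping the null point r = 0 leaves only r > 0 to consider,
    since the density vanishes for r < 0. *)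
Lemma ge0_integral_layer (dT : measure_display) (T : measurableType dT)
    (m : {sigma_finite_measure set T -> \bar R}) (q : T -> R) (W : T -> \bar R)
    (rate : R) : (0 < rate)%R ->
  measurable_fun setT q -> (forall x, (0 <= q x)%R) ->
  measurable_fun setT W -> (forall x, 0 <= W x) ->
  \int[m]_x (W x * (expR (- rate * q x))%:E) =
  \int[mu]_(r in [set~ 0%R]) ((exponential_pdf rate r)%:E *
    \int[m]_x (if (q x <= r)%R then W x else 0)).
Proof.
move=> rate0 mq q0 mW W0.
have mp := measurable_exponential_pdf rate.
have p0 := exponential_pdf_ge0 (ltW rate0).
pose h (z : T * R) :=
  if (q z.1 <= z.2)%R then W z.1 * (exponential_pdf rate z.2)%:E else 0.
have mh : measurable_fun setT h.
  apply: measurable_fun_ifT => //.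
    apply: measurable_fun_ler => //; exact: measurableT_comp.
  apply: emeasurable_funM; first exact: measurableT_comp.
  by apply/measurable_EFinP; exact: (measurableT_comp mp).
have h0 z : 0 <= h z by rewrite /h; case: ifP => // _; rewrite mule_ge0// lee_fin.
have mpi (a : R) : measurable_fun setT
    (fun r : R => (if (a <= r)%R then exponential_pdf rate r else 0%R)%:E).
  apply/measurable_EFinP; apply: measurable_fun_ifT => //.
  exact: measurable_fun_ler.
transitivity (\int[m]_x \int[mu]_r h (x, r)).
  apply: eq_integral => x _; rewrite -exponential_pdf_tail// -ge0_integralZl//.
  - apply: eq_integral => r _; rewrite /h/=; case: ifP => // _.
    by rewrite mule0.
  - exact: mpi.
  - by move=> r _; rewrite lee_fin; case: ifP.
transitivity (\int[mu]_r \int[m]_x h (x, r)).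
  exact: (@fubini_tonelli _ _ _ _ R m mu h).
have hE r : \int[m]_x h (x, r) = (exponential_pdf rate r)%:E *
    \int[m]_x (if (q x <= r)%R then W x else 0).
  rewrite -ge0_integralZl ?lee_fin//.
  - apply: eq_integral => x _; rewrite /h/=; case: ifP => _; last by rewrite mule0.
    by rewrite muleC.
  - by apply: measurable_fun_ifT => //; exact: measurable_fun_ler.
  - by move=> x _; case: ifP.
transitivity (\int[mu]_(r in [set~ 0%R]) \int[m]_x h (x, r)); last first.
  by apply: eq_integral => r _; exact: hE.
rewrite -setTD integral_setD1//; first exact: measurableD.
apply: measurable_funTS.
exact: (@measurable_fun_fubini_tonelli_G _ _ _ _ R m h).
Qed.

Lemma measurable_integral_sublevel (dT : measure_display) (T : measurableType dT)
    (m : {sigma_finite_measure set T -> \bar R}) (q : T -> R) (W : T -> \bar R) :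
  measurable_fun setT q -> measurable_fun setT W -> (forall x, 0 <= W x) ->
  measurable_fun setT (fun r : R => \int[m]_x (if (q x <= r)%R then W x else 0)).
Proof.
move=> mq mW W0.
pose h (z : T * R) := if (q z.1 <= z.2)%R then W z.1 else 0.
apply: (@measurable_fun_fubini_tonelli_G _ _ _ _ R m h).
  apply: measurable_fun_ifT => //; last exact: measurableT_comp.
  by apply: measurable_fun_ler => //; exact: measurableT_comp.
by move=> z; rewrite /h; case: ifP.
Qed.

End layer_cake.

(** * Comparison of the Gaussian squared norm with the Gamma integral *)

Section gauss_gamma.
Context {R : realType}.
Variables (k : nat) (C : R).
Hypotheses (k_gt0 : (0 < k)%N) (C_gt0 : 0 < C).
Local Open Scope ereal_scope.
Local Notation mu := (@lebesgue_measure R).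

Let s : R := Num.sqrt (k%:R^-1).
Let rate : R := ((2 * C ^+ 2 / k%:R)^-1)%R.
Let p : R := (k%:R / 2)%R.
Let q (w : k.-tuple R) : R := (C ^+ 2 * \sum_(i < k) tnth w i ^+ 2)%R.
Let E (w : k.-tuple R) : R := expR ((\sum_(i < k) tnth w i ^+ 2) / (s ^+ 2 *+ 2)).
Let g (x : R) : R := if (0 <= x)%R then (x `^ (p - 1))%R else 0%R.
Let V (t : R) := gaussvec_int s (fun w => if (q w <= t)%R then (E w)%:E else 0).
(** As [g] vanishes on negative numbers, this is the integral of x^(p - 1) over [0, t]. The absolute
    value makes the level function nonnegative on the whole line, as [ge0_integral_layer]
    requires. *)
Let M (t : R) := \int[mu]_x (if (`|x| <= t)%R then (g x)%:E else 0).

Let k_neq0 : (k%:R != 0 :> R)%R.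
Proof. by rewrite pnatr_eq0 -lt0n. Qed.

Let C_neq0 : C != 0%R.
Proof. by rewrite gt_eqF. Qed.

Let s_neq0 : s != 0%R.
Proof. by rewrite gt_eqF// sqrtr_gt0 invr_gt0 ltr0n. Qed.

Let rate_gt0 : (0 < rate)%R.
Proof. by rewrite invr_gt0 divr_gt0 ?ltr0n// mulr_gt0// exprn_gt0. Qed.

(** Both exponents are k / 2 times the squared norm, since s^2 = 1 / k and rate C^2 = k / 2. *)
Let EE w : E w = expR (rate * q w).
Proof.
rewrite /E /rate /q /s sqr_sqrtr ?invr_ge0 ?ler0n//; congr expR.
rewrite -mulr_natr; field; rewrite k_neq0/= C_neq0.
by rewrite ?andbT.
Qed.

Let q_ge0 w : (0 <= q w)%R.
Proof. by rewrite mulr_ge0 ?sqr_ge0// sumr_ge0// => i _; exact: sqr_ge0. Qed.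

Let mq : measurable_fun setT q.
Proof. by apply: measurable_funM => //; exact: measurable_sqnorm. Qed.

Let mE : measurable_fun setT E.
Proof.
apply: measurableT_comp => //; apply: measurable_funM => //.
exact: measurable_sqnorm.
Qed.

Let mg : measurable_fun setT g.
Proof.
apply: measurable_fun_ifT => //.
exact: (measurable_fun_ler (measurable_cst _) (@measurable_id _ _ _)).
Qed.

Let g_ge0 x : (0 <= g x)%R.
Proof. by rewrite /g; case: ifP => // _; exact: powR_ge0. Qed.

(** Scaling by c = 1 / sqrt t carries {q <= t} to {q <= 1}, and [gaussvec_int_scale] supplies the
    power of c. *)
Let V_homogeneous t : (0 < t)%R -> V t = (Num.sqrt t ^+ k)%:E * V 1.
Proof.
move=> t0; have st0 : (0 < Num.sqrt t)%R by rewrite sqrtr_gt0.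
pose f (w : k.-tuple R) : \bar R := if (q w <= 1)%R then 1 else 0.
have mf : measurable_fun setT f.
  by apply: measurable_fun_ifT => //; exact: measurable_fun_ler.
have f0 w : 0 <= f w by rewrite /f; case: ifP.
have c0 : (0 < (Num.sqrt t)^-1)%R by rewrite invr_gt0.
have := gaussvec_int_scale s_neq0 c0 mf f0.
set A := (X in _ * X = _ -> _); set B := (X in _ = X -> _) => AB.
have -> : V t = A.
  congr iter_int; apply/funext => w; rewrite /f.
  have -> : (q (tscale (Num.sqrt t)^-1 w) <= 1)%R = (q w <= t)%R.
    rewrite /q; under eq_bigr do rewrite tnth_mktuple exprMn exprVn sqr_sqrtr ?(ltW t0)//.
    by rewrite -mulr_sumr mulrCA mulrC ler_pdivrMr// mul1r.
  by case: ifP => _; rewrite ?mule1 ?mule0.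
have -> : V 1 = B.
  congr iter_int; apply/funext => w; rewrite /f.
  by case: ifP => _; rewrite ?mule1 ?mule0.
by rewrite -AB muleA -EFinM exprVn divff ?mul1e// expf_neq0// gt_eqF.
Qed.

Let M_homogeneous t : (0 < t)%R -> M t = (Num.sqrt t ^+ k)%:E * M 1.
Proof.
move=> t0.
(* Of t^p, the factor t is the Jacobian of x -> t x and t^(p - 1) comes out of [g]. *)
have -> : (Num.sqrt t ^+ k = t * t `^ (p - 1))%R.
  rewrite -{2}[t]powRr1 ?ltW// -powRD; last by rewrite (gt_eqF t0) implybT.
  rewrite addrCA subrr addr0 /p mulrC powRrM powR12_sqrt ?ltW// powR_mulrn//.
have mM u : measurable_fun setT (fun x : R => if (`|x| <= u)%R then (g x)%:E else 0).
  apply: measurable_fun_ifT => //; last exact/measurable_EFinP.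
  by apply: measurable_fun_ler => //; exact: measurableT_comp.
have M0 u x : 0 <= (if (`|x| <= u)%R then (g x)%:E else 0).
  by case: ifP => // _; rewrite lee_fin.
rewrite /M -(ge0_integral_scale_pos t0 (mM t) (M0 t)) EFinM -muleA; congr *%E.
rewrite -ge0_integralZl ?lee_fin ?powR_ge0//; last exact: mM.
apply: eq_integral => x _.
rewrite normrM gtr0_norm// ger_pMr//; case: ifP => _; last by rewrite mule0.
rewrite /g pmulr_rge0//; case: ifP => [x0|_]; last by rewrite mule0.
by rewrite powRM ?(ltW t0).
Qed.

Let V1_fin_num : V 1 \is a fin_num.
Proof.
have [Q IQ] := gaussvec_integrates s k.
have mV : measurable_fun setT (fun w => if (q w <= 1)%R then (E w)%:E else 0).
  apply: measurable_fun_ifT => //; last exact/measurable_EFinP.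
  exact: measurable_fun_ler.
have V0 w : 0 <= (if (q w <= 1)%R then (E w)%:E else 0).
  by case: ifP => // _; rewrite lee_fin expR_ge0.
rewrite ge0_fin_numE; last exact: (integrates_ge0 IQ).
apply: (@le_lt_trans _ _ (expR rate)%:E); last exact: ltry.
rewrite -(integrates_cst IQ (c := (expR rate)%:E)) ?lee_fin ?expR_ge0//.
apply: (le_integrates IQ) => // w; case: ifP => [q1|_]; last by rewrite lee_fin expR_ge0.
by rewrite EE lee_fin ler_expR ger_pMr.
Qed.

Let mW (dT : measure_display) (T : measurableType dT) (q0 : T -> R) (W : T -> R)
    (B : R -> bool) : measurable_fun setT B -> measurable_fun setT q0 ->
  measurable_fun setT W ->
  measurable_fun setT (fun x => if B (q0 x) then (W x)%:E else 0).
Proof.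
move=> mB mq0 mW; apply: measurable_fun_ifT => //; last exact/measurable_EFinP.
exact: measurableT_comp.
Qed.

(* Both sides are mixtures, over the same exponential level r, of functions of r
   that are homogeneous of the same degree, hence proportional. *)
Let gauss_gamma_proportional (B : R -> bool) :
  measurable_fun setT B ->
  (forall r, (0 < r)%R -> exists2 r', (0 < r')%R &
    forall x, ((x <= r)%R && B x) = (x <= r')%R) ->
  M 1 * gaussvec_int s (fun w => if B (q w) then 1 else 0) =
  V 1 * \int[mu]_x (if B `|x|%R then (g x * expR (- rate * `|x|))%:E else 0).
Proof.
move=> mB HB.
have [Q IQ] := gaussvec_integrates s k.
have mabs : measurable_fun setT (fun x : R => `|x|%R) by exact: normr_measurable.
pose W w : \bar R := if B (q w) then (E w)%:E else 0.
pose G (x : R) : \bar R := if B `|x|%R then (g x)%:E else 0.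
have mW' : measurable_fun setT W by exact: mW.
have mG : measurable_fun setT G by exact: mW.
have W0 w : 0 <= W w by rewrite /W; case: ifP => // _; rewrite lee_fin expR_ge0.
have G0 x : 0 <= G x by rewrite /G; case: ifP => // _; rewrite lee_fin.
have m1 : measurable_fun setT (fun w => if B (q w) then 1 else 0 : \bar R).
  by apply: (mW (W := fun=> 1%R)).
(* Inserting 1 = E exp(- rate q) gives the integrand the exponential factor needed for the
   layer-cake formula. *)
have -> : gaussvec_int s (fun w => if B (q w) then 1 else 0) =
    \int[Q]_w (W w * (expR (- rate * q w))%:E).
  rewrite IQ//; last by move=> w; case: ifP.
  apply: eq_integral => w _; rewrite /W; case: ifP => _; last by rewrite mul0e.
  by rewrite EE -EFinM -expRD mulNr subrr expR0.
have -> : \int[mu]_x (if B `|x|%R then (g x * expR (- rate * `|x|))%:E else 0) =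
    \int[mu]_x (G x * (expR (- rate * `|x|))%:E).
  by apply: eq_integral => x _; rewrite /G; case: ifP => _; rewrite ?mul0e// EFinM.
rewrite (ge0_integral_layer Q rate_gt0 mq)//.
rewrite (ge0_integral_layer mu rate_gt0 mabs)//.
have V1_ge0 : 0 <= V 1.
  apply: (integrates_ge0 IQ); last first.
    by move=> w; case: ifP => // _; rewrite lee_fin expR_ge0.
  by apply: (mW (B := fun x => (x <= 1)%R)) => //; exact: measurable_fun_ler.
have M1_ge0 : 0 <= M 1.
  by apply: integral_ge0 => x _; case: ifP => // _; rewrite lee_fin.
have mpdf : measurable_fun setT (fun r : R => (exponential_pdf rate r)%:E).
  by apply/measurable_EFinP; exact: measurable_exponential_pdf.
have pdf0 (r : R) : 0 <= (exponential_pdf rate r)%:E.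
  by rewrite lee_fin exponential_pdf_ge0// ltW.
have FQ0 (r : R) : 0 <= \int[Q]_w (if (q w <= r)%R then W w else 0).
  by apply: integral_ge0 => w _; case: ifP.
have FM0 (r : R) : 0 <= \int[mu]_x (if (`|x| <= r)%R then G x else 0).
  by apply: integral_ge0 => x _; case: ifP.
have mFQ : measurable_fun ([set~ 0%R] : set R) (fun r : R => (exponential_pdf rate r)%:E *
    \int[Q]_w (if (q w <= r)%R then W w else 0)).
  apply: measurable_funTS; apply: emeasurable_funM => //.
  exact: measurable_integral_sublevel.
have mFM : measurable_fun ([set~ 0%R] : set R) (fun r : R => (exponential_pdf rate r)%:E *
    \int[mu]_x (if (`|x| <= r)%R then G x else 0)).
  apply: measurable_funTS; apply: emeasurable_funM => //.
  exact: (measurable_integral_sublevel mu mabs).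
have m0 : measurable ([set~ 0%R] : set R).
  by apply: measurableC; exact: measurable_set1.
rewrite -ge0_integralZl//; last by move=> r _; rewrite mule_ge0.
rewrite -ge0_integralZl//; last by move=> r _; rewrite mule_ge0.
apply: eq_integral => r /[!inE]/= /eqP r0.
have [r_lt0|r_gt0|/eqP] := ltgtP r 0%R; last by rewrite (negPf r0).
  by rewrite lt0_exponential_pdf// !mul0e !mule0.
(* Cutting by [B] and by the level r amounts to cutting at r', so the inner integrals are [V r'] and
   [M r'], the same power of sqrt r' times [V 1] and [M 1]. *)
have [r' r'0 HB'] := HB _ r_gt0.
have -> : \int[Q]_w (if (q w <= r)%R then W w else 0) = V r'.
  rewrite /V IQ; last 2 first.
  - by apply: (mW (B := fun x => (x <= r')%R)) => //; exact: measurable_fun_ler.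
  - by move=> w; case: ifP => // _; rewrite lee_fin expR_ge0.
  apply: eq_integral => w _; rewrite /W -HB'.
  by case: (q w <= r)%R.
have -> : \int[mu]_x (if (`|x| <= r)%R then G x else 0) = M r'.
  apply: eq_integral => x _; rewrite /G -HB'.
  by case: (`|x| <= r)%R.
rewrite (V_homogeneous r'0) (M_homogeneous r'0).
rewrite muleCA [RHS]muleCA; congr *%E.
by rewrite muleCA [RHS]muleCA; congr *%E; rewrite muleC.
Qed.

Let gamma_int_le t : (0 <= t)%R ->
  \int[mu]_(x in `[0%R, t]%classic) (gamma_dens p (2 * C ^+ 2 / k%:R) x)%:E =
  \int[mu]_x (if (`|x| <= t)%R then (g x * expR (- rate * `|x|))%:E else 0).
Proof.
move=> t0; rewrite integral_mkcond; apply: eq_integral => x _.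
rewrite patchE mem_setE in_itv/= /g; have [x0|x0] /= := leP 0%R x; last first.
  by rewrite mul0r; case: ifP.
rewrite ger0_norm//; case: ifP => // _.
rewrite /gamma_dens; congr (_ * expR _)%:E; rewrite !mulNr; congr (- _)%R.
exact: mulrC.
Qed.

Let gamma_int :
  \int[mu]_(x in `[0%R, +oo[%classic) (gamma_dens p (2 * C ^+ 2 / k%:R) x)%:E =
  \int[mu]_x (g x * expR (- rate * `|x|))%:E.
Proof.
rewrite integral_mkcond; apply: eq_integral => x _.
rewrite patchE mem_setE in_itv/= andbT /g; have [x0|x0] /= := leP 0%R x; last first.
  by rewrite mul0r.
rewrite ger0_norm// /gamma_dens; congr (_ * expR _)%:E; rewrite !mulNr.
by congr (- _)%R; exact: mulrC.
Qed.

(** Two instances of proportionality, one cut at t and one uncut, give [V 1] D F = [V 1] N, with F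
    the Gaussian mass of {q <= t}. Hence F = N / D, the Gamma distribution function at t, and the
    complementary mass is at most b. *)
Lemma gauss_norm_tail (t b : R) : (0 < t)%R ->
  (1 - b)%:E <= gamma_cdf (k%:R / 2) (2 * C ^+ 2 / k%:R) t ->
  gaussvec_int (Num.sqrt (k%:R^-1)) (fun w : k.-tuple R =>
    if (C ^+ 2 * \sum_(i < k) tnth w i ^+ 2 <= t)%R then 0 else 1) <= b%:E.
Proof.
move=> t0; rewrite /gamma_cdf gamma_int (gamma_int_le (ltW t0)).
pose N := \int[mu]_x (if (`|x| <= t)%R then (g x * expR (- rate * `|x|))%:E else 0).
pose D := \int[mu]_x (g x * expR (- rate * `|x|))%:E.
rewrite -/N -/D => cdf.
have [Q IQ] := gaussvec_integrates s k.
have mt : measurable_fun setT (fun x : R => (x <= t)%R) by exact: measurable_fun_ler.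
have mqt : measurable_fun setT (fun w => (q w <= t)%R).
  exact: (measurable_fun_ler mq (measurable_cst t)).
have mabs : measurable_fun setT (fun x : R => `|x|%R) by exact: normr_measurable.
pose F w : \bar R := if (q w <= t)%R then 1 else 0.
pose F' w : \bar R := if (q w <= t)%R then 0 else 1.
have mF : measurable_fun setT F by exact: measurable_fun_ifT.
have mF' : measurable_fun setT F' by exact: measurable_fun_ifT.
have F0 w : 0 <= F w by rewrite /F; case: ifP.
have F'0 w : 0 <= F' w by rewrite /F'; case: ifP.
change (gaussvec_int s F' <= b%:E).
have FF' : gaussvec_int s F + gaussvec_int s F' = 1.
  rewrite -(integratesD IQ)// -[RHS](integrates_cst IQ)//.
  congr iter_int; apply/funext => w; rewrite /F /F'.
  by case: ifP => _; rewrite ?adde0 ?add0e.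
have IF0 := integrates_ge0 IQ mF F0.
have IF'0 := integrates_ge0 IQ mF' F'0.
have triv : (1 <= b)%R -> gaussvec_int s F' <= b%:E.
  move=> b1; apply: (@le_trans _ _ 1); last by rewrite lee_fin.
  by rewrite -FF' leeDr.
have me : measurable_fun setT (fun x : R => (g x * expR (- rate * `|x|))%R).
  apply: measurable_funM => //; apply: measurableT_comp => //.
  exact: measurable_funM.
have e0 (x : R) : (0 <= g x * expR (- rate * `|x|))%R.
  by rewrite mulr_ge0// expR_ge0.
have meE : measurable_fun setT (fun x : R => (g x * expR (- rate * `|x|))%:E).
  exact/measurable_EFinP.
have mgE : measurable_fun setT (EFin \o g) by exact/measurable_EFinP.
have mN : measurable_fun setT (fun x : R =>
    if (`|x| <= t)%R then (g x * expR (- rate * `|x|))%:E else 0).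
  exact: (mW (q0 := fun x : R => `|x|%R) mt mabs me).
have N0 : 0 <= N by apply: integral_ge0 => x _; case: ifP => // _; rewrite lee_fin.
have D0 : 0 <= D by apply: integral_ge0 => x _; rewrite lee_fin.
have ND : N <= D.
  apply: ge0_le_integral => //.
  - by move=> x _; case: ifP => // _; rewrite lee_fin.
  - by move=> x _; case: ifP => // _; rewrite lee_fin.
have H1 : M 1 * gaussvec_int s F = V 1 * N.
  apply: (@gauss_gamma_proportional (fun x => (x <= t)%R)) => // r r0.
  (* The cuts at r and at t combine into one cut at their minimum. *)
  exists (Num.min r t); first by rewrite lt_min r0.
  by move=> x; rewrite le_min.
(* Without a cut the Gaussian mass is 1, which expresses the normalising integral D. *)
have H2 : M 1 = V 1 * D.
  rewrite -[LHS]mule1 -[in LHS](integrates_cst IQ (c := 1))//.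
  apply: (@gauss_gamma_proportional xpredT) => // r r0.
  by exists r => // x; rewrite andbT.
(* When D is 0 or +oo the quotient N / D is 0 in \bar R, which forces 1 <= b. *)
move: D0 ND cdf; rewrite le_eqVlt => /predU1P[<-|D0] ND.
  have -> : N = 0 by apply/eqP; rewrite eq_le ND N0.
  by rewrite mul0e lee_fin subr_le0; exact: triv.
have [Doo|Dfin] := eqVneq D +oo.
  rewrite Doo /inve mule0 lee_fin subr_le0; exact: triv.
(* If [V 1] were 0, so would be [M 1], hence [M r] for all r > 0 by homogeneity, and the layer-cake
   formula would give D = 0. *)
have V1N0 : V 1 != 0.
  apply/eqP => V10; have M10 : M 1 = 0 by rewrite H2 V10 mul0e.
  move: D0; rewrite /D.
  under eq_integral do rewrite EFinM.
  rewrite (ge0_integral_layer mu (W := EFin \o g) rate_gt0 mabs)//.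
  rewrite integral0_eq ?ltxx// => r /= /eqP r0.
  have [r_lt0|r_gt0|/eqP] := ltgtP r 0%R; last by rewrite (negPf r0).
    by rewrite lt0_exponential_pdf// mul0e.
  by rewrite -/(M r) M_homogeneous// M10 !mule0.
have Dfin' : D \is a fin_num.
  by rewrite ge0_fin_numE ?ltW// ltey.
have Nfin : N \is a fin_num by rewrite ge0_fin_numE// (le_lt_trans ND)// ltey_eq Dfin'.
have Ffin : gaussvec_int s F \is a fin_num.
  rewrite ge0_fin_numE//; apply: (@le_lt_trans _ _ 1); last exact: ltry.
  by rewrite -FF' leeDl.
have F'fin : gaussvec_int s F' \is a fin_num.
  rewrite ge0_fin_numE//; apply: (@le_lt_trans _ _ 1); last exact: ltry.
  by rewrite -FF' leeDr.
move: H1 FF'; rewrite H2.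
move: D0 V1N0; rewrite -(fineK V1_fin_num) -(fineK Dfin') -(fineK Nfin).
rewrite -(fineK Ffin) -(fineK F'fin).
move: (fine (V 1)) (fine D) (fine N) (fine (gaussvec_int s F)) (fine (gaussvec_int s F')).
move=> v d n f f'; rewrite lte_fin eqe => d0 v0.
rewrite -!EFinM -EFinD => -[] H [] ff'.
rewrite /inve gt_eqF// -EFinM !lee_fin.
have -> : n = (d * f)%R.
  by apply: (mulfI v0); rewrite -H mulrA.
by rewrite mulrAC divff ?gt_eqF// mul1r; lra.
Qed.

End gauss_gamma.

(** * Privacy *)

Section dp.
Context {R : realType} (X : Type) (d k : nat).
Context (C Ct sigma eps delta delta' : R) (z : X -> d.-tuple R).
Hypotheses (k_gt0 : (0 < k)%N) (C_gt0 : 0 < C) (Ct_gt0 : 0 < Ct).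
Hypotheses (delta_ge0 : 0 <= delta).
Hypothesis mechDP : DP_sensitivity (@gauss_mech_prob R k sigma) Ct eps delta.
Hypothesis cdf : (gamma_cdf (k%:R / 2) (2 * C ^+ 2 / k%:R) (Ct ^+ 2) >=
  (1 - delta')%:E)%E.
Local Open Scope ereal_scope.

Let s : R := Num.sqrt (k%:R^-1).
Let S (D : seq X) (P : d.-tuple (k.-tuple R)) :=
  \big[@tadd R k/tzero k]_(x <- D) projT P (z x).

Let s_neq0 : s != 0%R.
Proof. by rewrite gt_eqF// sqrtr_gt0 invr_gt0 ltr0n. Qed.

(** The projection has the law of |v| w. Since |v| <= C, the event |v| |w| > Ct lies in C^2 |w|^2 >
    Ct^2, whose mass is bounded by [gauss_norm_tail]. *)
Lemma projT_tail (v : d.-tuple R) : (tnorm2 v <= C)%R ->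
  gaussmx_int (fun P : d.-tuple (k.-tuple R) =>
    if (tnorm2 (projT P v) <= Ct)%R then 0 else 1) <= delta'%:E.
Proof.
move=> vC; apply: le_trans (gauss_norm_tail k_gt0 C_gt0 _ cdf); last first.
  by rewrite exprn_gt0.
pose G (u : k.-tuple R) : \bar R := if (tnorm2 u <= Ct)%R then 0 else 1.
have mle (c : R) : measurable_fun setT
    (fun u : k.-tuple R => (c * \sum_(i < k) tnth u i ^+ 2 <= Ct ^+ 2)%R).
  apply: measurable_fun_ler => //; apply: measurable_funM => //.
  exact: measurable_sqnorm.
have GE (u : k.-tuple R) : G u =
    if (1 * \sum_(i < k) tnth u i ^+ 2 <= Ct ^+ 2)%R then 0 else 1.
  by rewrite /G tnorm2_le ?(ltW Ct_gt0)// mul1r.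
have mG : measurable_fun setT G.
  by rewrite (funext GE); apply: measurable_fun_ifT.
have G0 u : 0 <= G u by rewrite /G; case: ifP.
rewrite /gaussmx_int (gaussmx_int_projT s_neq0 v mG G0).
have [Q IQ] := gaussvec_integrates s k.
apply: (le_integrates IQ).
- by apply: (measurableT_comp mG); exact: measurable_tscale.
- by move=> w; exact: G0.
- exact: measurable_fun_ifT.
move=> w; rewrite /G tnorm2_le ?(ltW Ct_gt0)// sqnorm_tscale.
case: ifPn => [_|Hv]; first by case: ifP.
rewrite ifF//; apply: contraNF Hv; apply: le_trans.
rewrite ler_wpM2r ?sumr_ge0// => [i _|]; rewrite ?sqr_ge0//.
by rewrite ler_sqr ?nnegrE ?sqrtr_ge0// ltW.
Qed.

(** Only the norm of the difference of the projected sums is prescribed, so one statement serves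
    both neighbouring relations and both orders of the datasets. *)
Lemma alg_prob_le (D1 D2 : seq X) (v : d.-tuple R) (A : set (k.-tuple R)) :
  (tnorm2 v <= C)%R ->
  (forall P, tnorm2 (tsub (S D1 P) (S D2 P)) = tnorm2 (projT P v)) ->
  measurable A ->
  alg_prob z sigma D1 A <=
    (expR eps)%:E * alg_prob z sigma D2 A + (delta + delta')%:E.
Proof.
move=> vC Sv mA.
have [Q IQ] := gaussvec_integrates s k.
have [Q' IQ'] := iter_int_integrates d IQ.
have [N IN] := gaussvec_integrates sigma k.
pose h (D : seq X) P := gauss_mech_prob sigma (S D P) A.
have mS D : measurable_fun setT (S D).
  by apply: measurable_bigtadd => x; exact: measurable_projT.
have mAk D : measurable_fun setT (fun y : d.-tuple (k.-tuple R) * k.-tuple R =>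
    (\1_A (tadd (S D y.1) y.2) : R)%:E).
  apply/measurable_EFinP; apply: (measurableT_comp (measurable_indic mA)).
  by apply: measurable_tadd => //; exact: measurableT_comp.
have mAP D P : measurable_fun setT (fun w : k.-tuple R => (\1_A (tadd (S D P) w) : R)%:E).
  apply/measurable_EFinP; apply: (measurableT_comp (measurable_indic mA)).
  exact: measurable_tadd.
have mh D : measurable_fun setT (h D).
  by apply: (measurable_integrates IN (mAk D)) => y; rewrite lee_fin.
have h0 D P : 0 <= h D P.
  by apply: (integrates_ge0 IN) => // w; rewrite lee_fin.
have h1 D P : h D P <= 1.
  rewrite -[leRHS](integrates_cst IN)//; apply: (le_integrates IN) => // w.
  by rewrite lee_fin indicE; case: (_ \in _).
pose B (P : d.-tuple (k.-tuple R)) : \bar R :=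
  if (tnorm2 (projT P v) <= Ct)%R then 0 else 1.
have B0 P : 0 <= B P by rewrite /B; case: ifP.
have mB : measurable_fun setT B.
  apply: measurable_fun_ifT => //.
  rewrite (_ : (fun _ => _) = fun P =>
    (\sum_(i < k) tnth (projT P v) i ^+ 2 <= Ct ^+ 2)%R); last first.
    by apply/funext => P; rewrite tnorm2_le// ltW.
  apply: measurable_fun_ler => //; apply: measurable_sqnorm.
  exact: measurable_projT.
have e0 : 0 <= (expR eps)%:E by rewrite lee_fin expR_ge0.
have meh : measurable_fun setT (fun P => (expR eps)%:E * h D2 P).
  exact: emeasurable_funM.
have eh0 P : 0 <= (expR eps)%:E * h D2 P by rewrite mule_ge0.
have mdB : measurable_fun setT (fun P => delta%:E + B P) by exact: emeasurable_funD.
have dB0 P : 0 <= delta%:E + B P by rewrite adde_ge0.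
(* The bound is pointwise in P: where the projection is short [B] is 0 and the mechanism is private;
   elsewhere [B] is 1, which alone dominates the probability on the left. *)
apply: (@le_trans _ _ (gaussmx_int (fun P => (expR eps)%:E * h D2 P + (delta%:E + B P)))).
  apply: (le_integrates IQ' (mh D1) (h0 D1)); first exact: emeasurable_funD.
  move=> P; rewrite /B; case: ifPn => PCt.
    by rewrite adde0; apply: mechDP => //; rewrite Sv.
  apply: (le_trans (h1 D1 P)); rewrite -[leLHS]add0e leeD//.
  by rewrite -[leLHS]add0e leeD.
rewrite /gaussmx_int (integratesD IQ')// (integratesZl IQ')//.
rewrite (integratesD IQ')// (integrates_cst IQ')// EFinD.
by rewrite leeD2l// leeD2l//; exact: projT_tail.
Qed.

Lemma alg_prob_DP_R : (forall x, tnorm2 (z x) <= C)%R ->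
  DP_for nbr_R (@alg_prob R X d k z sigma) eps (delta + delta').
Proof.
move=> zC D1 D2 [s1 [s2 [x HD]]] A mA.
apply: (alg_prob_le (v := z x)) => // P.
case: HD => [[-> ->]|[-> ->]]; congr Num.sqrt; apply: eq_bigr => j _.
- rewrite tnth_mktuple !tnth_bigtadd !big_cat big_cons /=.
  by congr (_ ^+ 2)%R; ring.
- rewrite tnth_mktuple !tnth_bigtadd !big_cat big_cons /=.
  (* When the record is added rather than removed, the difference changes sign, which the square
     absorbs. *)
  by rewrite -sqrrN; congr (_ ^+ 2)%R; ring.
Qed.

Lemma alg_prob_DP_S : (forall x, tnorm2 (z x) <= C / 2)%R ->
  DP_for nbr_S (@alg_prob R X d k z sigma) eps (delta + delta').
Proof.
move=> zC D1 D2 [s1 [s2 [x [y [_ [-> ->]]]]]] A mA.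
apply: (alg_prob_le (v := tsub (z x) (z y))) => [|P|//].
  by apply: tnorm2_tsub_le => //; exact: ltW.
congr Num.sqrt; apply: eq_bigr => j _.
rewrite tnth_mktuple tnth_projT_tsub !tnth_bigtadd !big_cat !big_cons /=.
by congr (_ ^+ 2)%R; ring.
Qed.

End dp.

Unset Implicit Arguments.
Set Strict Implicit.

Theorem theorem2 (R : realType) (X : Type) (d k : nat) (C Ct sigma eps delta delta' : R)
    (z : X -> d.-tuple R) :
  (0 < d)%N -> (0 < k)%N -> 0 < C -> 0 < Ct -> 0 < sigma ->
  0 < eps -> 0 <= delta <= 1 -> 0 < delta' ->
  DP_sensitivity (@gauss_mech_prob R k sigma) Ct eps delta ->
  (gamma_cdf (k%:R / 2) (2 * C ^+ 2 / k%:R) (Ct ^+ 2) >= (1 - delta')%:E)%E ->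
  ((forall x, tnorm2 (z x) <= C) ->
     DP_for nbr_R (@alg_prob R X d k z sigma) eps (delta + delta')) /\
  ((forall x, tnorm2 (z x) <= C / 2) ->
     DP_for nbr_S (@alg_prob R X d k z sigma) eps (delta + delta')).
Proof.
move=> _ k0 C0 Ct0 _ _ /andP[delta0 _] _ mechDP cdf; split.
- exact: (alg_prob_DP_R k0 C0 Ct0 delta0 mechDP cdf).
- exact: (alg_prob_DP_S k0 C0 Ct0 delta0 mechDP cdf).
Qed.
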